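(* For all real numbers $a,b>0$, $$\tfrac18 M_{AH}(a,b)\le M_{N_2N_1}(a,b)\le \tfrac13 M_{N_2G}(a,b)\le \tfrac14 M_{AG}(a,b)\le M_{AN_2}(a,b).$$
   Context: For $a,b>0$ define the means $H(a,b)=\frac{2ab}{a+b}$, $G(a,b)=\sqrt{ab}$, $N_1(a,b)=\left(\frac{\sqrt a+\sqrt b}{2}\right)^2$, $N_2(a,b)=\left(\frac{\sqrt a+\sqrt b}{2}\right)\sqrt{\frac{a+b}{2}}$, $A(a,b)=\frac{a+b}{2}$. The differences of means are $M_{AH}=A-H$, $M_{N_2N_1}=N_2-N_1$, $M_{N_2G}=N_2-G$, $M_{AG}=A-G$, $M_{AN_2}=A-N_2$, each evaluated at $(a,b)$. *)

(* Defs.v *)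
From Stdlib Require Import Reals.
Open Scope R_scope.

Definition mean_H (a b : R) : R := 2 * a * b / (a + b).
Definition mean_G (a b : R) : R := sqrt (a * b).
Definition mean_N1 (a b : R) : R := ((sqrt a + sqrt b) / 2) ^ 2.
Definition mean_N2 (a b : R) : R := (sqrt a + sqrt b) / 2 * sqrt ((a + b) / 2).
Definition mean_A (a b : R) : R := (a + b) / 2.

Definition M_AH (a b : R) : R := mean_A a b - mean_H a b.
Definition M_N2N1 (a b : R) : R := mean_N2 a b - mean_N1 a b.
Definition M_N2G (a b : R) : R := mean_N2 a b - mean_G a b.
Definition M_AG (a b : R) : R := mean_A a b - mean_G a b.
Definition M_AN2 (a b : R) : R := mean_A a b - mean_N2 a b.

(* Main.v *)
Require Import Defs.
From Stdlib Require Import Reals Lra.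
Open Scope R_scope.

(** Everything is rational in two positive numbers: [m], the arithmetic mean
    of [sqrt a] and [sqrt b], and [q], their quadratic mean.  Indeed
    [A = q^2], [N1 = m^2] and [N2 = m q]; moreover
    [(sqrt a + sqrt b)^2 = a + b + 2 sqrt (a b)] reads [4 m^2 = 2 q^2 + 2 G],
    whence [G = 2 m^2 - q^2], and [H = G^2 / A].

    In these coordinates the gap in each of the four inequalities is a
    nonnegative multiple of [(q - m)^2]: the factors are, in order,
    [m (2 q + m) / (2 q^2)], [1/3], [1/6] and [1/2].  The common square
    reflects that all five scaled differences agree to second order at
    [a = b]. *)

Definition root_mean (a b : R) : R := (sqrt a + sqrt b) / 2.
Definition root_qmean (a b : R) : R := sqrt ((a + b) / 2).

Lemma root_mean_gt0 (a b : R) : 0 < a -> 0 < b -> 0 < root_mean a b.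
Proof.
intros ha hb; unfold root_mean.
pose proof (sqrt_lt_R0 a ha); pose proof (sqrt_lt_R0 b hb); lra.
Qed.

Lemma root_qmean_gt0 (a b : R) : 0 < a -> 0 < b -> 0 < root_qmean a b.
Proof. intros ha hb; apply sqrt_lt_R0; lra. Qed.

Lemma mean_A_qmean (a b : R) :
  0 < a -> 0 < b -> mean_A a b = root_qmean a b ^ 2.
Proof.
intros ha hb; unfold mean_A, root_qmean.
rewrite pow2_sqrt; lra.
Qed.

(** The binomial square of [sqrt a + sqrt b], solved for its cross term. *)
Lemma mean_G_qmean (a b : R) : 0 < a -> 0 < b ->
  mean_G a b = 2 * root_mean a b ^ 2 - root_qmean a b ^ 2.
Proof.
intros ha hb.
rewrite <- mean_A_qmean by assumption.
unfold mean_G, mean_A, root_mean.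
rewrite sqrt_mult by lra.
pose proof (pow2_sqrt a (Rlt_le _ _ ha)) as Ea.
pose proof (pow2_sqrt b (Rlt_le _ _ hb)) as Eb.
replace (a + b) with (sqrt a ^ 2 + sqrt b ^ 2) by lra.
field.
Qed.

Lemma mean_H_G2_div_A (a b : R) : 0 < a -> 0 < b ->
  mean_H a b = mean_G a b ^ 2 / mean_A a b.
Proof.
intros ha hb; unfold mean_H, mean_G, mean_A.
rewrite pow2_sqrt by (apply Rmult_le_pos; lra).
field; lra.
Qed.

Lemma le_of_gap (x y c t : R) : 0 <= c -> y - x = c * t ^ 2 -> x <= y.
Proof.
intros hc E.
pose proof (Rmult_le_pos c (t ^ 2) hc (pow2_ge_0 t)); lra.
Qed.

Theorem theorem3p2 : forall (a b : R) (ha : 0 < a) (hb : 0 < b),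
  1 / 8 * M_AH a b <= M_N2N1 a b /\
  M_N2N1 a b <= 1 / 3 * M_N2G a b /\
  1 / 3 * M_N2G a b <= 1 / 4 * M_AG a b /\
  1 / 4 * M_AG a b <= M_AN2 a b.
Proof.
intros a b ha hb.
unfold M_AH, M_N2N1, M_N2G, M_AG, M_AN2.
rewrite mean_H_G2_div_A, mean_G_qmean, mean_A_qmean by assumption.
change (mean_N1 a b) with (root_mean a b ^ 2).
change (mean_N2 a b) with (root_mean a b * root_qmean a b).
pose proof (root_mean_gt0 a b ha hb) as hm.
pose proof (root_qmean_gt0 a b ha hb) as hq.
set (m := root_mean a b) in *; set (q := root_qmean a b) in *.
repeat split.
- apply (le_of_gap _ _ (m * (2 * q + m) / (2 * q ^ 2)) (q - m)).
  + apply Rlt_le, Rdiv_lt_0_compat.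
    * apply Rmult_lt_0_compat; lra.
    * pose proof (pow_lt q 2 hq); lra.
  + field; lra.
- apply (le_of_gap _ _ (1 / 3) (q - m)); [lra | field].
- apply (le_of_gap _ _ (1 / 6) (q - m)); [lra | field].
- apply (le_of_gap _ _ (1 / 2) (q - m)); [lra | field].
Qed.
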